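(* Let $r,p,s,n$ be positive integers such that $p\mid r$, $s\mid r$ and $ps\mid rn$. Then, as formal power series in $t,q,a$, $$\Bigg\{\sum_{k\geq 0}t^k\left([k+1]_{q^{r/s}}+aq\,[k]_{q^{r/s}}\Big[\frac{r}{s}-1\Big]_{aq}\right)^n\Bigg\}_{q^p}=\frac{\sum_{g\in G(r,p,s,n)}t^{\mathrm{des}(g)}q^{\mathrm{fmaj}(g)}a^{\mathrm{col}(g)}}{(1-t)(1-t^sq^r)(1-t^sq^{2r})\cdots(1-t^sq^{(n-1)r})(1-tq^{nr/s})}.$$
   Context: Notation. For a positive integer $m$, $R_m(i)\in\{0,\ldots,m-1\}$ denotes the residue of $i\in\mathbb Z$ modulo $m$. $[m]_x=1+x+\cdots+x^{m-1}$, with $[0]_x=0$. For a power series $F$, $\{F\}_{q^p}$ is obtained from $F$ by discarding all terms whose degree in $q$ is not divisible by $p$. Groups. $G(r,n)$ is the group of pairs $(c_1,\ldots,c_n;\sigma)$ with $c_i\in\{0,\ldots,r-1\}$ (the colors) and $\sigma\in S_n$, with product $(d_1,\ldots,d_n;\tau)(c_1,\ldots,c_n;\sigma)=(R_r(c_1+d_{\sigma(1)}),\ldots,R_r(c_n+d_{\sigma(n)});\tau\sigma)$. For $p\mid r$, $G(r,p,n)$ is the subgroup of elements with $c_1+\cdots+c_n\equiv 0 \bmod p$. For $s\mid r$ with $ps\mid rn$, $C_s\subseteq G(r,p,n)$ is the cyclic subgroup of order $s$ generated by $(r/s,\ldots,r/s;\mathrm{id})$, and $G(r,p,s,n)=G(r,p,n)/C_s$.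 Statistics. For $g\in G(r,p,s,n)$ represented by $(c_1,\ldots,c_n;\sigma)$ let $\mathrm{HDes}(g)=\{i\in\{1,\ldots,n-1\}: c_i=c_{i+1},\ \sigma(i)>\sigma(i+1)\}$, $h_i(g)=\#\{j\ge i: j\in\mathrm{HDes}(g)\}$, $k_n(g)=R_{r/s}(c_n)$, $k_i(g)=k_{i+1}(g)+R_r(c_i-c_{i+1})$ for $1\le i\le n-1$, $\lambda_i(g)=r\,h_i(g)+k_i(g)$. Then $\mathrm{fmaj}(g)=\sum_{i=1}^n\lambda_i(g)$, $\mathrm{des}(g)=\left\lfloor\frac{s\lambda_1(g)+r-s}{r}\right\rfloor$, $\mathrm{col}(g)=\sum_{i=1}^nR_{r/s}(c_i)$. These do not depend on the representative chosen. *)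

(* Defs.v *)
From HB Require Import structures.
From mathcomp Require Import all_boot all_order all_fingroup all_algebra.
From mathcomp Require Import zify.
From mathcomp Require boolp.

Set Implicit Arguments.
Unset Strict Implicit.
Unset Printing Implicit Defensive.

Import GRing.Theory.

Local Open Scope ring_scope.

(* Univariate formal power series over a commutative ring R; series in several
   variables are obtained by iterating, e.g. {fps {fps R}}. *)

Record fps (R : Type) := Fps { coefs : nat -> R }.

Notation "{ 'fps' R }" := (fps R) (format "{ 'fps'  R }") : type_scope.

HB.instance Definition _ (R : Type) := boolp.gen_eqMixin {fps R}.
HB.instance Definition _ (R : Type) := boolp.gen_choiceMixin {fps R}.

Lemma fpsP (R : Type) (f g : {fps R}) : coefs f =1 coefs g <-> f = g.
Proof.
split=> [|->//]; case: f g => [f] [g] /= fg.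
by congr Fps; apply: boolp.funext.
Qed.

Section FpsRing.
Variable R : comUnitRingType.
Implicit Types f g h : {fps R}.

Definition fps0 : {fps R} := Fps (fun=> 0).
Definition fps_add f g := Fps (fun n => coefs f n + coefs g n).
Definition fps_opp f := Fps (fun n => - coefs f n).

Fact fps_addA : associative fps_add.
Proof. by move=> f g h; apply/fpsP => n /=; rewrite addrA. Qed.
Fact fps_addC : commutative fps_add.
Proof. by move=> f g; apply/fpsP => n /=; rewrite addrC. Qed.
Fact fps_add0 : left_id fps0 fps_add.
Proof. by move=> f; apply/fpsP => n /=; rewrite add0r. Qed.
Fact fps_addN : left_inverse fps0 fps_opp fps_add.
Proof. by move=> f; apply/fpsP => n /=; rewrite addNr. Qed.

HB.instance Definition _ :=
  GRing.isZmodule.Build {fps R} fps_addA fps_addC fps_add0 fps_addN.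

Definition fpsC (c : R) : {fps R} := Fps (fun n => if n == 0%N then c else 0).
Definition fpsX : {fps R} := Fps (fun n => if n == 1%N then 1 else 0).
Definition fps_mul f g :=
  Fps (fun n => \sum_(i < n.+1) coefs f i * coefs g (n - i)%N).

Definition fps_trunc m f : {poly R} := \poly_(i < m) coefs f i.

Lemma coef_fps_trunc m n f : (n < m)%N -> (fps_trunc m f)`_n = coefs f n.
Proof. by move=> ltnm; rewrite coef_poly ltnm. Qed.

Lemma coef_fps_mul m n f g : (n < m)%N ->
  coefs (fps_mul f g) n = (fps_trunc m f * fps_trunc m g)`_n.
Proof.
move=> ltnm; rewrite coefM; apply: eq_bigr => i _; rewrite !coef_fps_trunc //.
  exact: leq_ltn_trans (leq_subr i n) ltnm.
exact: leq_ltn_trans (leq_ord i) ltnm.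
Qed.

Fact fps_mulA : associative fps_mul.
Proof.
move=> f g h; apply/fpsP => n.
transitivity ((fps_trunc n.+1 f * (fps_trunc n.+1 g * fps_trunc n.+1 h))`_n).
  rewrite coefM; apply: eq_bigr => i _; rewrite coef_fps_trunc //.
  by congr (_ * _); apply: coef_fps_mul; rewrite ltnS leq_subr.
rewrite mulrA coefM; apply: eq_bigr => i _.
by rewrite -(coef_fps_mul f g (ltn_ord i)) coef_fps_trunc ?ltnS ?leq_subr.
Qed.

Fact fps_mulC : commutative fps_mul.
Proof.
by move=> f g; apply/fpsP => n; rewrite !(@coef_fps_mul n.+1) // mulrC.
Qed.

Fact fps_mul1 : left_id (fpsC 1) fps_mul.
Proof.
move=> f; apply/fpsP => n /=; rewrite big_ord_recl /= mul1r subn0 big1 ?addr0 //.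
by move=> i _; rewrite mul0r.
Qed.

Fact fps_mulDl : left_distributive fps_mul fps_add.
Proof.
move=> f g h; apply/fpsP => n /=; rewrite -big_split /=.
by apply: eq_bigr => i _; rewrite mulrDl.
Qed.

Fact fps_1_neq0 : fpsC 1 != 0.
Proof. by apply/eqP => /fpsP /(_ 0%N) /eqP; rewrite /= oner_eq0. Qed.

HB.instance Definition _ := GRing.Zmodule_isComNzRing.Build {fps R}
  fps_mulA fps_mulC fps_mul1 fps_mulDl fps_1_neq0.

(* A power series is invertible iff its constant term is; the coefficients of
   the inverse are computed recursively, and the inverse of a non-unit is itself
   by the usual MathComp convention. *)
Definition fps_unit : pred {fps R} := fun f => coefs f 0%N \is a GRing.unit.

Fixpoint fps_inv_seq f n : seq R :=
  if n is m.+1 then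
    let s := fps_inv_seq f m in
    rcons s (- (coefs f 0%N)^-1 * \sum_(i < m.+1) coefs f (m.+1 - i)%N * s`_i)
  else [:: (coefs f 0%N)^-1].

Definition fps_inv f :=
  if fps_unit f then Fps (fun n => (fps_inv_seq f n)`_n) else f.

Lemma size_fps_inv_seq f n : size (fps_inv_seq f n) = n.+1.
Proof. by elim: n => //= n IHn; rewrite size_rcons IHn. Qed.

Lemma nth_fps_inv_seq f m n : (m <= n)%N ->
  (fps_inv_seq f n)`_m = (fps_inv_seq f m)`_m.
Proof.
elim: n => [|n IHn]; first by rewrite leqn0 => /eqP->.
rewrite leq_eqVlt ltnS => /orP[/eqP->//|lemn] /=.
by rewrite nth_rcons size_fps_inv_seq ltnS lemn IHn.
Qed.

Fact fps_mulVf : {in fps_unit, left_inverse (1 : {fps R}) fps_inv *%R}.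
Proof.
move=> f f_unit; rewrite /fps_inv ifT // mulrC; apply/fpsP => -[|n].
  by rewrite /= big_ord_recl big_ord0 addr0 mulrV.
transitivity (\sum_(i < n.+2) coefs f (n.+1 - i)%N * (fps_inv_seq f n.+1)`_i).
  rewrite mulrC; apply: eq_bigr => i _ /=.
  by rewrite mulrC -(@nth_fps_inv_seq _ i n.+1) // -ltnS.
rewrite big_ord_recr /= subnn nth_rcons size_fps_inv_seq ltnn eqxx.
rewrite mulrA mulrN mulrV // mulN1r; apply/eqP; rewrite subr_eq0; apply/eqP.
by apply: eq_bigr => i _; rewrite nth_rcons size_fps_inv_seq ltn_ord.
Qed.

Fact fps_unitPl f g : g * f = 1 -> fps_unit f.
Proof.
move=> /fpsP /(_ 0%N); rewrite /= big_ord_recl big_ord0 addr0 subn0 => gf.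
by apply/unitrPr; exists (coefs g 0%N); rewrite mulrC.
Qed.

Fact fps_inv_out : {in [predC fps_unit], fps_inv =1 id}.
Proof. by move=> f /negPf f_nunit; rewrite /fps_inv [fps_unit f]f_nunit. Qed.

HB.instance Definition _ := GRing.ComNzRing_hasMulInverse.Build {fps R}
  fps_mulVf fps_unitPl fps_inv_out.

End FpsRing.

Arguments fpsC {R} c.
Arguments fpsX {R}.

(* Z[[a]][[q]][[t]]: the outermost variable is t, then q, then a. *)
Notation fps_qa := {fps {fps int}}.
Notation fps_tqa := {fps {fps {fps int}}}.

(* {F}_{q^p}: only the terms whose degree in q is divisible by p are kept. *)
Definition qfilter (p : nat) (F : fps_tqa) : fps_tqa :=
  Fps (fun i => Fps (fun j => if (p %| j)%N then coefs (coefs F i) j else 0)).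

(* [m]_x *)
Definition qint (S : pzRingType) (m : nat) (x : S) : S := \sum_(i < m) x ^+ i.

(* R_m(i) *)
Definition residue (m : nat) (i : int) : nat := `|(i %% m)%Z|%N.

(* Elements (c_1, ..., c_n; sigma) of G(r, n), with positions indexed from 0.
   For r > 0 the color type is {0, ..., r - 1}, with addition modulo r. *)
Record colored_perm (r n : nat) := ColoredPerm {
  color : {ffun 'I_n -> 'I_r.-1.+1};
  uperm : 'S_n
}.

Section ColoredPermGroup.
Variables r n : nat.
Implicit Types g h k : colored_perm r n.

Definition colored_perm_pair g := (color g, uperm g).
Definition pair_colored_perm (x : {ffun 'I_n -> 'I_r.-1.+1} * 'S_n) :=
  ColoredPerm x.1 x.2.
Fact colored_perm_pairK : cancel colored_perm_pair pair_colored_perm.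
Proof. by case. Qed.

HB.instance Definition _ :=
  Finite.copy (colored_perm r n) (can_type colored_perm_pairK).

(* (d; tau)(c; sigma) = (c_i + d_(sigma i); tau o sigma); the MathComp product
   of permutations is in diagrammatic order, (s * t) i = t (s i). *)
Definition colored_perm_mul g h : colored_perm r n :=
  ColoredPerm [ffun i => color h i + color g (uperm h i)]
              (uperm h * uperm g)%g.
Definition colored_perm_one : colored_perm r n := ColoredPerm [ffun=> 0] 1%g.
Definition colored_perm_inv g : colored_perm r n :=
  ColoredPerm [ffun i => - color g ((uperm g)^-1%g i)] (uperm g)^-1%g.

Lemma colored_permP g h :
  color g =1 color h -> uperm g = uperm h -> g = h.
Proof. by case: g h => [c s] [d t] /= /ffunP-> ->. Qed.

Fact colored_perm_mulA : associative colored_perm_mul.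
Proof.
move=> g h k; apply: colored_permP => [i|] /=; last by rewrite mulgA.
by rewrite !ffunE permM addrA.
Qed.
Fact colored_perm_mul1 : left_id colored_perm_one colored_perm_mul.
Proof.
move=> g; apply: colored_permP => [i|] /=; last by rewrite mulg1.
by rewrite !ffunE addr0.
Qed.
Fact colored_perm_mulV :
  left_inverse colored_perm_one colored_perm_inv colored_perm_mul.
Proof.
move=> g; apply: colored_permP => [i|] /=; last by rewrite mulgV.
by rewrite !ffunE permK subrr.
Qed.

HB.instance Definition _ := Finite_isGroup.Build (colored_perm r n)
  colored_perm_mulA colored_perm_mul1 colored_perm_mulV.

(* G(r, p, n) *)
Definition Grpn (p : nat) : {set colored_perm r n} :=
  [set g | (p %| \sum_(i < n) (color g i : nat))%N].

(* C_s *)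
Definition Cs (s : nat) : {set colored_perm r n} :=
  <[ColoredPerm [ffun=> inZp (r %/ s)] 1]>%g.
Canonical Cs_group (s : nat) := Eval hnf in [group of Cs s].

Lemma group_set_Grpn (p : nat) : (0 < r)%N -> (p %| r)%N -> group_set (Grpn p).
Proof.
move=> r_gt0 p_r; apply/group_setP; split=> [|g h].
  by rewrite inE big1 // => i _; rewrite ffunE.
rewrite !inE => pg ph.
have /(_ (index_enum _)) colorM s : (\sum_(i <- s) color (g * h)%g i
    = \sum_(i <- s) (color h i + color g (uperm h i)) %[mod p])%N.
  elim: s => [|i s IHs]; rewrite ?big_nil // !big_cons -modnDm IHs modnDm.
  by rewrite -modnDml ffunE /= modn_dvdm ?prednK // modnDml.
rewrite /dvdn colorM big_split /= -/(dvdn _ _) dvdn_addr //.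
by move: pg; rewrite (reindex_perm (uperm h)).
Qed.

End ColoredPermGroup.

Lemma Cs_normal (r n p s : nat) :
    (0 < r)%N -> (p %| r)%N -> (s %| r)%N -> (p * s %| r * n)%N ->
  (Cs r n s <| Grpn r n p)%g.
Proof.
move=> r_gt0 p_r s_r ps_rn.
set G := Group (group_set_Grpn n r_gt0 p_r).
rewrite -[Grpn r n p]/(G : {set _}).
pose z : colored_perm r n := ColoredPerm [ffun=> inZp (r %/ s)] 1%g.
have s_gt0 : (0 < s)%N by apply: dvdn_gt0 s_r.
have zG : z \in G.
  rewrite inE /= (eq_bigr (fun=> r %/ s %% r)%N) => [|i _]; last first.
    by rewrite ffunE /= prednK.
  rewrite sum_nat_const card_ord /dvdn -modnMmr modn_dvdm // modnMmr.
  rewrite -/(dvdn _ _) -(dvdn_pmul2r s_gt0) -mulnA divnK //.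
  by rewrite (mulnC n).
rewrite /normal cycle_subG zG (subset_trans _ (cent_sub _)) //.
apply/subsetP=> g _; rewrite cent_cycle; apply/cent1P.
apply: colored_permP => [i|] /=; last by rewrite mulg1 mul1g.
by rewrite !ffunE perm1 addrC.
Qed.

(* The quotient G(r, p, s, n) = G(r, p, n) / C_s, whose elements are the cosets
   of C_s in G(r, p, n). *)
Definition Grpsn (r p s n : nat) : {set coset_of (Cs r n s)} :=
  (Grpn r n p / Cs r n s)%g.

(* Positions are 0-based: color_at g i and perm_at g i are c_(i+1) and
   sigma(i+1) - 1 in 1-based notation, and the descent set, h, k and lambda are
   shifted accordingly; in particular lambda g 0 is lambda_1(g). *)
Section Statistics.
Variables r s n : nat.
Implicit Types g : colored_perm r n.

(* The default value 0 is only used for positions outside {0, ..., n - 1}. *)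
Definition color_at g (i : nat) : nat :=
  nth 0%N [seq (color g j : nat) | j <- enum 'I_n] i.
Definition perm_at g (i : nat) : nat :=
  nth 0%N [seq (uperm g j : nat) | j <- enum 'I_n] i.

Lemma color_atE g i (ltin : (i < n)%N) : color_at g i = color g (Ordinal ltin).
Proof.
rewrite /color_at (nth_map (Ordinal ltin)) ?size_enum_ord //.
by congr (nat_of_ord (color g _)); apply: (nth_ord_enum _ (Ordinal ltin)).
Qed.

Lemma perm_atE g i (ltin : (i < n)%N) : perm_at g i = uperm g (Ordinal ltin).
Proof.
rewrite /perm_at (nth_map (Ordinal ltin)) ?size_enum_ord //.
by congr (nat_of_ord (uperm g _)); apply: (nth_ord_enum _ (Ordinal ltin)).
Qed.

Definition HDes g : {set 'I_n.-1} :=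
  [set i : 'I_n.-1 | (color_at g i == color_at g i.+1)
                     && (perm_at g i > perm_at g i.+1)%N].

Definition h_stat g (i : nat) : nat := #|[set j in HDes g | (i <= j)%N]|.

(* k_rev g m is k_(n - m)(g) in 1-based notation. *)
Fixpoint k_rev g (m : nat) : nat :=
  if m is m'.+1 then
    (k_rev g m'
     + residue r ((color_at g (n - m'.+2))%:Z - (color_at g (n - m'.+1))%:Z))%N
  else residue (r %/ s) (color_at g n.-1)%:Z.

Definition k_stat g (i : nat) : nat := k_rev g (n.-1 - i).

Definition lambda g (i : nat) : nat := (r * h_stat g i + k_stat g i)%N.

Definition cp_fmaj g : nat := (\sum_(i < n) lambda g i)%N.

Definition cp_des g : nat := ((s * lambda g 0 + r - s) %/ r)%N.

Definition cp_col g : nat :=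
  (\sum_(i < n) residue (r %/ s) (color_at g i)%:Z)%N.

(* These values do not depend on the representative: see fmaj_coset, des_coset
   and col_coset below. *)
Definition fmaj (x : coset_of (Cs r n s)) : nat := cp_fmaj (repr x).
Definition des (x : coset_of (Cs r n s)) : nat := cp_des (repr x).
Definition col_stat (x : coset_of (Cs r n s)) : nat := cp_col (repr x).

End Statistics.

Section Representatives.
Variables r s n : nat.
Hypotheses (r_gt0 : (0 < r)%N) (s_r : (s %| r)%N).
Implicit Types g : colored_perm r n.

Let d_r : (r %/ s %| r)%N.
Proof. by rewrite -{2}(divnK s_r) dvdn_mulr. Qed.

Lemma Cs_cent g : g \in 'C(Cs r n s)%g.
Proof.
rewrite cent_cycle; apply/cent1P; apply: colored_permP => [i|] /=.
  by rewrite !ffunE perm1 addrC.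
by rewrite mulg1 mul1g.
Qed.

Lemma color_Cs g (z : colored_perm r n) : z \in Cs r n s ->
  uperm (z * g)%g = uperm g /\
  exists2 m : nat, (r %/ s %| m)%N &
    forall i, color (z * g)%g i = ((color g i + m) %% r)%N :> nat.
Proof.
case/cycleP => m ->; elim: m => [|m [IHu [m' d_m' IHc]]].
  rewrite expg0 mul1g; split=> //; exists 0%N => // i.
  by rewrite addn0 modn_small // -[X in (_ < X)%N](prednK r_gt0) ltn_ord.
rewrite expgS -mulgA; split; first by rewrite /= mulg1.
exists (m' + r %/ s)%N; rewrite ?dvdn_addr // => i.
have modE (x y : nat) : ((x + y %% r.-1.+1) %% r.-1.+1 = (x + y) %% r)%N.
  by rewrite prednK // modnDmr.
by rewrite ffunE /= IHc ffunE /= modE modnDml addnA.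
Qed.

Lemma color_at_Cs g (z : colored_perm r n) : z \in Cs r n s ->
  perm_at (z * g)%g =1 perm_at g /\
  exists2 m : nat, (r %/ s %| m)%N &
    forall i, (i < n)%N -> color_at (z * g)%g i = ((color_at g i + m) %% r)%N.
Proof.
move=> /(color_Cs g)[u [m d_m c]]; split=> [i|]; first by rewrite /perm_at u.
by exists m => // i ltin; rewrite !(color_atE _ ltin) c.
Qed.

Lemma color_at_lt g i : (color_at g i < r)%N.
Proof.
have [ltin|lein] := ltnP i n.
  by rewrite color_atE -[X in (_ < X)%N](prednK r_gt0) ltn_ord.
by rewrite /color_at nth_default // size_map size_enum_ord.
Qed.

Lemma residue_shift (i m : nat) : (r %/ s %| m)%N ->
  residue (r %/ s) ((i + m) %% r)%N%:Z = residue (r %/ s) i%:Z.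
Proof.
by move=> d_m; rewrite /residue !modz_nat modn_dvdm // -modnDmr (eqP d_m) addn0.
Qed.

Lemma residue_sub_shift (i j m : nat) :
  residue r (((i + m) %% r)%N%:Z - ((j + m) %% r)%N%:Z)
  = residue r (i%:Z - j%:Z).
Proof.
rewrite /residue -!modz_nat; congr absz.
by rewrite modzDml -modzDmr modzNm modzDmr !PoszD opprD addrACA subrr addr0.
Qed.

Lemma stats_Cs g (z : colored_perm r n) : (0 < n)%N -> z \in Cs r n s ->
  [/\ lambda s (z * g)%g =1 lambda s g & cp_col s (z * g)%g = cp_col s g].
Proof.
move=> n_gt0 /(color_at_Cs g)[u [m d_m c]]; split; last first.
  by apply: eq_bigr => i _; rewrite c // residue_shift.
have HDesE : HDes (z * g)%g = HDes g.
  apply/setP=> i; have lti := ltn_ord i.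
  rewrite !inE !u !c; [|lia|lia]; congr (_ && _).
  by rewrite eqn_modDr !modn_small // color_at_lt.
have kE : k_rev s (z * g)%g =1 k_rev s g.
  elim=> [|k IHk] /=; first by rewrite c ?residue_shift // prednK.
  by rewrite IHk !c ?residue_sub_shift //; lia.
by move=> i; rewrite /lambda /h_stat /k_stat HDesE kE.
Qed.

Lemma repr_coset_Cs g :
  exists2 z, z \in Cs r n s & repr (coset (Cs r n s) g) = (z * g)%g.
Proof.
have Ng : g \in 'N(Cs r n s)%g by apply: subsetP (cent_sub _) _ (Cs_cent g).
have := mem_repr_coset (coset (Cs r n s) g).
by rewrite val_coset // => /rcosetP[z z_Cs ->]; exists z.
Qed.

Lemma fmaj_coset g : (0 < n)%N -> fmaj (coset (Cs r n s) g) = cp_fmaj s g.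
Proof.
move=> n_gt0; rewrite /fmaj; have [z zC ->] := repr_coset_Cs g.
by have [lE _] := stats_Cs g n_gt0 zC; apply: eq_bigr => i _; rewrite lE.
Qed.

Lemma des_coset g : (0 < n)%N -> des (coset (Cs r n s) g) = cp_des s g.
Proof.
move=> n_gt0; rewrite /des; have [z zC ->] := repr_coset_Cs g.
by have [lE _] := stats_Cs g n_gt0 zC; rewrite /cp_des lE.
Qed.

Lemma col_coset g : (0 < n)%N -> col_stat (coset (Cs r n s) g) = cp_col s g.
Proof.
move=> n_gt0; rewrite /col_stat; have [z zC ->] := repr_coset_Cs g.
by have [] := stats_Cs g n_gt0 zC.
Qed.

End Representatives.

(* Main.v *)
(** With e = r / s, the coefficient of t^K on the left is the sum, over all
    functions f from n positions to {0, ..., e K} whose total is divisible by p,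
    of q^(sum of f) a^(sum of the residues of f modulo e).  Sorting the values
    of f decreasingly, with ties broken by position, yields a permutation sigma;
    the sorted values L_1 >= ... >= L_n determine a coloring of sigma through
    c_i = L_i - e floor(L_n / e) modulo r, and L_i exceeds lambda_i by
    the sum over j >= i of r m_j (for j < n) and e m_n (for j = n).  The map from
    f to (colored permutation, m) is a bijection, the m_j are the exponents in
    the geometric expansion of the denominator, and the colored permutations
    obtained are those with c_n < e, one in each coset of C_s. *)

From HB Require Import structures.
Require Import Defs.
From mathcomp Require Import all_boot all_order all_fingroup all_algebra.
From mathcomp Require Import zify ring.

Set Implicit Arguments.
Unset Strict Implicit.
Unset Printing Implicit Defensive.

Import GRing.Theory.

Local Open Scope ring_scope.

(** * Coefficients of power series and geometric expansions *)

Section FpsTheory.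
Variable R : comUnitRingType.
Implicit Types (u : R) (F G : {fps R}).

Lemma coefs_mul F G k :
  coefs (F * G) k = \sum_(i < k.+1) coefs F i * coefs G (k - i)%N.
Proof. by []. Qed.

Lemma coefs_sum (I : Type) (s : seq I) (P : pred I) (F : I -> {fps R}) k :
  coefs (\sum_(i <- s | P i) F i) k = \sum_(i <- s | P i) coefs (F i) k.
Proof. by rewrite (big_morph (fun F => coefs F k) (id1 := 0) (op1 := +%R)). Qed.

Lemma coefs_fpsC_mul u F k : coefs (fpsC u * F) k = u * coefs F k.
Proof.
rewrite coefs_mul big_ord_recl /= subn0 big1 ?addr0 // => i _.
by rewrite mul0r.
Qed.

Fact fpsC_is_zmod_morphism : zmod_morphism (@fpsC R).
Proof. by move=> u v; apply/fpsP => -[|k] //=; rewrite subr0. Qed.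

Fact fpsC_is_monoid_morphism : monoid_morphism (@fpsC R).
Proof.
split=> // u v; apply/fpsP => k; rewrite coefs_fpsC_mul /=.
by case: k => //= k; rewrite mulr0.
Qed.

HB.instance Definition _ :=
  GRing.isZmodMorphism.Build R {fps R} fpsC fpsC_is_zmod_morphism.
HB.instance Definition _ :=
  GRing.isMonoidMorphism.Build R {fps R} fpsC fpsC_is_monoid_morphism.

Lemma coefs_fpsX_mul F k :
  coefs (fpsX * F) k = if k is k'.+1 then coefs F k' else 0.
Proof.
case: k => [|k]; first by rewrite coefs_mul big_ord1 mul0r.
rewrite coefs_mul big_ord_recl mul0r add0r big_ord_recl mul1r subn1 big1 ?addr0 //.
by move=> i _; rewrite mul0r.
Qed.

Lemma coefs_fpsXn_mul b F k :
  coefs (fpsX ^+ b * F) k = if (b <= k)%N then coefs F (k - b) else 0.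
Proof.
elim: b k => [|b IHb] k; first by rewrite mul1r subn0.
by rewrite exprS -mulrA coefs_fpsX_mul; case: k => // k; rewrite IHb.
Qed.

Lemma coefs_monom b u k :
  coefs (fpsX ^+ b * fpsC u) k = if b == k then u else 0.
Proof.
by rewrite coefs_fpsXn_mul /= subn_eq0; case: ltngtP.
Qed.

Lemma unit_sub1X F : 1 - fpsX * F \is a GRing.unit.
Proof.
suff: coefs (1 - fpsX * F) 0 \is a GRing.unit by [].
rewrite [coefs _ _](_ : _ = 1 - coefs (fpsX * F) 0) //.
by rewrite coefs_fpsX_mul subr0 unitr1.
Qed.

(** Writing [F] as [F / (1 - fpsX)] times [1 - fpsX] makes the coefficients of [F] the successive
    differences of those of the quotient. *)
Lemma coefs_div_sub1X F k :
  coefs (F / (1 - fpsX)) k = \sum_(i < k.+1) coefs F i.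
Proof.
have U : 1 - fpsX \is a @GRing.unit {fps R} by rewrite -[fpsX]mulr1 unit_sub1X.
elim: k => [|k IHk].
  rewrite -{2}[F](mulrVK U) mulrBr mulr1 mulrC (mulrC _ fpsX).
  rewrite big_ord1 [RHS](_ : _ = coefs ((1 - fpsX)^-1 * F) 0 -
     coefs (fpsX * (F / (1 - fpsX))) 0); last by rewrite (mulrC _ F).
  by rewrite coefs_fpsX_mul subr0.
rewrite big_ord_recr /= -IHk -{3}[F](mulrVK U) mulrBr mulr1 (mulrC _ fpsX).
rewrite [X in _ = _ + X](_ : _ = coefs (F / (1 - fpsX)) k.+1 -
   coefs (fpsX * (F / (1 - fpsX))) k.+1) //.
by rewrite coefs_fpsX_mul [RHS]addrC subrK.
Qed.

(* Modulo t ^ (k + 1), the inverse of 1 - M is the truncated geometric series of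
   M as soon as t divides M. *)
Lemma coefs_div_prod_geom (I : finType) (M : I -> {fps R}) F k :
  (forall i, exists H, M i = fpsX * H) ->
  coefs (F / \prod_i (1 - M i)) k =
  coefs (\sum_(m : {ffun I -> 'I_k.+1}) F * \prod_i M i ^+ m i) k.
Proof.
move=> XM; have U : \prod_i (1 - M i) \is a GRing.unit.
  by apply: rpred_prod => i _; have [H ->] := XM i; apply: unit_sub1X.
pose S := \prod_i \sum_(m < k.+1) M i ^+ m.
(* Each factor times its truncated geometric series telescopes to [1 - M i ^+ k.+1], which is 1
   modulo [fpsX ^+ k.+1]; the congruence survives the product, and the error cannot reach
   coefficient [k]. *)
have [H DS] : exists H, 1 - (\prod_i (1 - M i)) * S = fpsX ^+ k.+1 * H.
  rewrite -big_split /= (eq_bigr (fun i => 1 - M i ^+ k.+1)); last first.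
    by move=> i _; rewrite -[1 in RHS](expr1n _ k.+1) subrXX; congr (_ * _);
      apply: eq_bigr => j _; rewrite expr1n mul1r.
  elim/big_rec: _ => [|i x _ [H Hx]]; first by exists 0; rewrite mulr0 subrr.
  have [Mi ->] := XM i.
  exists (H + Mi ^+ k.+1 * x); rewrite mulrDr -Hx exprMn.
  by move: (fpsX ^+ _) (Mi ^+ _) => y z; ring.
rewrite -mulr_sumr -(bigA_distr_bigA (fun i (m : 'I_k.+1) => M i ^+ m)) -/S.
set D := \prod_i (1 - M i) in U DS *.
have -> : F / D = F * S + fpsX ^+ k.+1 * (H * (F / D)).
  rewrite mulrA -DS mulrBl mul1r [D * S * _]mulrC mulrA.
  by rewrite (mulrVK U) addrC subrK.
by rewrite [LHS](_ : _ = coefs (F * S) k + coefs (fpsX ^+ k.+1 * (H * (F / D))) k)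
  // coefs_fpsXn_mul ltnn addr0.
Qed.

End FpsTheory.

(** * The left-hand side as a sum over functions *)

(** Exponents divisible by [e] give the first summand; the others are [e j + i + 1] with [j < K] and
    [i < e - 1], contributing [q^(e j) (a q)^(i + 1)]. *)
Lemma sum_X_modn (S : comPzRingType) (q a : S) (e K : nat) : (0 < e)%N ->
  \sum_(x < (e * K).+1) q ^+ x * a ^+ (x %% e) =
  qint K.+1 (q ^+ e) + a * q * qint K (q ^+ e) * qint e.-1 (a * q).
Proof.
case: e => // e _; elim: K => [|k IHk].
  by rewrite muln0 /qint !big_ord1 big_ord0 mod0n !mulr1 mulr0 mul0r addr0.
have -> : (e.+1 * k.+1).+1 = ((e.+1 * k).+1 + e.+1)%N by lia.
rewrite big_split_ord IHk /= /qint [in RHS]big_ord_recr.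
rewrite [X in _ = _ + _ * X * _]big_ord_recr [X in _ + X = _]big_ord_recr /=.
rewrite (_ : (e.+1 * k).+1 + e = e.+1 * k.+1)%N; last by lia.
rewrite modnMr mulr1 -exprM.
set A := \sum_(i < k.+1) _; set B := \sum_(i < k) _; set C := \sum_(i < e) _.
set D := \sum_(i < e) _.
suff -> : D = a * q * (q ^+ (e.+1 * k)) * C by rewrite -?exprM; ring.
rewrite mulr_sumr; apply: eq_bigr => i _.
have -> : (((e.+1 * k).+1 + i) %% e.+1 = i.+1)%N.
  by rewrite addSnnS mulnC modnMDl modn_small ?ltnS.
by rewrite addSn exprS exprD exprS exprMn; ring.
Qed.

(** Expanding the power by distributivity, each function yields a single monomial whose [q]-degree
    is its total, so the filter selects functions. *)
Lemma coef_qfilter_power (p K e n : nat) : (0 < e)%N ->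
  let q : fps_qa := fpsX in let a : fps_qa := fpsC fpsX in
  forall F : fps_tqa,
  coefs F K = (qint K.+1 (q ^+ e) + a * q * qint K (q ^+ e) * qint e.-1 (a * q)) ^+ n ->
  coefs (qfilter p F) K =
  \sum_(f : {ffun 'I_n -> 'I_(e * K).+1} | (p %| \sum_i f i)%N)
     q ^+ (\sum_i f i)%N * a ^+ (\sum_i f i %% e)%N.
Proof.
move=> e_gt0 q a F FK; apply/fpsP => j.
rewrite [LHS](_ : _ = if (p %| j)%N then coefs (coefs F K) j else 0) // FK -sum_X_modn //.
rewrite -[X in _ ^+ X]card_ord -prodr_const bigA_distr_bigA !coefs_sum.
rewrite [RHS]big_mkcond.
have E (f : {ffun 'I_n -> 'I_(e * K).+1}) :
    coefs (\prod_i (q ^+ f i * a ^+ (f i %% e))) j =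
    coefs (q ^+ (\sum_i f i)%N * a ^+ (\sum_i f i %% e)%N) j.
  by rewrite big_split /= -!expr_sum.
rewrite (eq_bigr _ (fun f _ => E f)).
have E' (f : {ffun 'I_n -> 'I_(e * K).+1}) :
    coefs (q ^+ (\sum_i f i)%N * a ^+ (\sum_i f i %% e)%N) j =
    if (\sum_i f i)%N == j then fpsX ^+ (\sum_i f i %% e)%N else 0.
  by rewrite /a -rmorphXn coefs_monom.
case: ifP => pj.
  apply: eq_bigr => f _; rewrite E'; case: eqP => [->|_]; first by rewrite pj.
  by case: ifP.
rewrite big1 // => f _; case: ifP => // pf; rewrite E'.
by case: eqP pf => // ->; rewrite pj.
Qed.

(** * The permutation sorting a function *)

Section SortingPermutation.
Variable n : nat.
Implicit Types (f : 'I_n -> nat) (sigma tau : 'S_n).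

(** Breaking ties by position makes this a strict total order, so each [f] has exactly one sorting
    permutation. *)
Definition rank_lt f : rel 'I_n :=
  fun x y => (f y < f x)%N || (f x == f y) && (x < y)%N.

Lemma rank_lt_trans f : transitive (rank_lt f).
Proof. by rewrite /rank_lt => y x z; lia. Qed.

Lemma rank_lt_irr f : irreflexive (rank_lt f).
Proof. by move=> x; rewrite /rank_lt !ltnn andbF. Qed.

Lemma rank_lt_perm_inj f sigma tau :
  sorted (rank_lt f) [seq sigma i | i <- enum 'I_n] ->
  sorted (rank_lt f) [seq tau i | i <- enum 'I_n] -> sigma = tau.
Proof.
move=> ss st; apply/permP => i.
have E : [seq sigma i | i <- enum 'I_n] = [seq tau i | i <- enum 'I_n].
  apply: irr_sorted_eq (@rank_lt_trans f) (@rank_lt_irr f) _ _ ss st _ => x.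
  have memc (u : 'S_n) : x \in [seq u i | i <- enum 'I_n].
    by apply/mapP; exists (u^-1 x)%g; rewrite ?mem_enum ?permKV.
  by rewrite !memc.
by move/eq_in_map: E; apply; rewrite mem_enum.
Qed.

Lemma rank_lt_perm_exists f :
  exists sigma, sorted (rank_lt f) [seq sigma i | i <- enum 'I_n].
Proof.
(* Sorting uses the reflexive closure, which is total; distinctness of the entries then turns each
   [le] between neighbours back into [rank_lt]. *)
pose le x y := (x == y) || rank_lt f x y.
have le_total : total le.
  by move=> x y; rewrite /le /rank_lt -!val_eqE /=; lia.
have [sigma sigmaE] : exists sigma : 'S_n,
    [seq sigma i | i <- enum 'I_n] = sort le (enum 'I_n).
  have /tuple_permP[sigma E] : perm_eq (sort le (enum 'I_n)) (ord_tuple n).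
    by rewrite perm_sort val_ord_tuple.
  by exists sigma; rewrite E; apply: eq_map => i; rewrite tnth_ord_tuple.
exists sigma; have := sort_sorted le_total (enum 'I_n); rewrite -sigmaE.
have: uniq [seq sigma i | i <- enum 'I_n].
  by rewrite map_inj_uniq ?enum_uniq //; apply: perm_inj.
case: [seq _ | _ <- _] => //= x l; elim: l x => //= y l IHl x.
case/andP; rewrite inE negb_or => /andP[xy _] /[dup] /IHl {}IHl.
by move=> _ /andP[]; rewrite {1}/le (negPf xy) /= => -> /IHl.
Qed.

End SortingPermutation.

(** * Levels and their relation to the statistics *)

Section Encoding.
Variables r s n : nat.
Hypotheses (r_gt0 : (0 < r)%N) (s_r : (s %| r)%N).

Let e := (r %/ s)%N.
Let s_gt0 : (0 < s)%N := dvdn_gt0 r_gt0 s_r.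
Let rE : r = (e * s)%N. Proof. by rewrite /e divnK. Qed.
Let e_gt0 : (0 < e)%N.
Proof. by move: r_gt0; rewrite {1}rE muln_gt0 => /andP[]. Qed.

Implicit Types (g : colored_perm r n.+1) (m : 'I_n.+1 -> nat).

Lemma residue_lt i : (residue r i < r)%N.
Proof. rewrite /residue; have := ltz_pmod i (d := r); have := modz_ge0 i (d := r). lia. Qed.

Lemma residue_subK x y : (residue r (x%:Z - y%:Z) + y = x %[mod r])%N.
Proof.
have r0 : r%:Z != 0 by rewrite eqz_nat -lt0n.
apply/eqP; rewrite -eqz_nat -!modz_nat; apply/eqP.
by rewrite PoszD /residue gez0_abs ?modz_ge0 // modzDml subrK.
Qed.

(** The drop of [lambda] from position [i] to the next. *)
Definition step g (i : nat) : nat :=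
  (r * ((color_at g i == color_at g i.+1) && (perm_at g i.+1 < perm_at g i))
   + residue r ((color_at g i)%:Z - (color_at g i.+1)%:Z))%N.

Lemma lambda_last g : lambda s g n = (color_at g n %% e)%N.
Proof.
rewrite /lambda /k_stat /= subnn /= /residue modz_nat /= /h_stat.
by rewrite (_ : [set _ in _ | _] = set0) ?cards0 ?muln0 //;
  apply/setP => j; rewrite !inE [(n <= j)%N]leqNgt ltn_ord andbF.
Qed.

Lemma lambda_step g i : (i < n)%N -> lambda s g i = (lambda s g i.+1 + step g i)%N.
Proof.
move=> ltin; have h_step : h_stat g i = (h_stat g i.+1 +
    ((color_at g i == color_at g i.+1) && (perm_at g i.+1 < perm_at g i)))%N.
  rewrite /h_stat (cardsD1 (Ordinal ltin)) !inE /= leqnn andbT addnC.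
  congr (_ + _)%N; apply: eq_card => j; rewrite !inE -val_eqE /=.
  by case: (ltngtP i j); rewrite ?andbT ?andbF.
rewrite /lambda /step h_step /k_stat /= -(subnSK ltin) /=.
have -> : (n.+1 - (n - i.+1).+2 = i)%N by lia.
have -> : (n.+1 - (n - i.+1).+1 = i.+1)%N by lia.
by lia.
Qed.

(* In 1-based notation, the factor of index j + 1 in the denominator is
   1 - t ^ slack j * q ^ (wt j * (j + 1)). *)
Definition wt (j : nat) : nat := if j == n then e else r.

(** The sorted values L_1 >= ... >= L_n of the function that [g] and [m] encode. *)
Definition level g m (i : nat) : nat :=
  (lambda s g i + \sum_(j < n.+1 | i <= j) wt j * m j)%N.

Lemma level_last g m : level g m n = (color_at g n %% e + e * m ord_max)%N.
Proof.
rewrite /level lambda_last (big_pred1 ord_max) /= /wt ?eqxx // => j.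
by rewrite /= -val_eqE /= eqn_leq -[(j <= n)%N]ltnS ltn_ord.
Qed.

Lemma level_step g m i (ltin : (i < n.+1)%N) : (i < n)%N ->
  level g m i = (level g m i.+1 + step g i + r * m (Ordinal ltin))%N.
Proof.
move=> lti; rewrite /level lambda_step // (bigD1 (Ordinal ltin)) //=.
rewrite /wt ltn_eqF // [X in (_ + (_ + X))%N](eq_bigl (fun j : 'I_n.+1 => (i < j)%N)).
  by lia.
by move=> j; rewrite -val_eqE /= eq_sym ltn_neqAle andbC.
Qed.

(** Index [j] adds [wt j * m j] to each of the [j + 1] positions up to [j], whence the exponents of
    [q] in the denominator. *)
Lemma sum_level g m :
  (\sum_(i < n.+1) level g m i = cp_fmaj s g + \sum_(j < n.+1) wt j * j.+1 * m j)%N.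
Proof.
rewrite /level big_split /=; congr (_ + _)%N.
rewrite (exchange_big_dep predT) //=; apply: eq_bigr => j _.
rewrite (eq_bigl (fun i : 'I_n.+1 => i < j.+1)%N) //.
by rewrite (big_ord_narrow (ltn_ord j)) sum_nat_const card_ord mulnCA mulnA.
Qed.

Definition slack (j : nat) : nat := if j == n then 1 else s.

(** [cp_des] is lambda_1 divided by [e] and rounded up, and [wt j] is [e * slack j], so the bound
    can be divided by [e]. *)
Lemma level0_le g m K : (level g m 0 <= e * K)%N =
  (cp_des s g + \sum_(j < n.+1) slack j * m j <= K)%N.
Proof.
rewrite /level (eq_bigr (fun j : 'I_n.+1 => e * (slack j * m j))%N); last first.
  by move=> j _; rewrite /wt /slack mulnA; case: ifP; rewrite ?muln1 // -rE.
rewrite -big_distrr /=; set M := (\sum_(j < _) _)%N.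
have -> : cp_des s g = ((lambda s g 0 + e.-1) %/ e)%N.
  rewrite /cp_des [in RHS]/e -[in RHS](divnMl s_gt0) -/e; congr (_ %/ _)%N.
    by rewrite {2}rE; nia.
  by rewrite {1}rE mulnC.
move: (lambda _ _ _) => x.
have := divn_eq (x + e.-1) e; have := ltn_pmod (x + e.-1) e_gt0.
by move: (_ %% _)%N (_ %/ _)%N => a b; nia.
Qed.

(** The descent and [m] terms are multiples of [r], so color minus level is constant modulo [r]: the
    levels and the last color determine all colors. *)
Lemma color_level g m i (ltin : (i < n.+1)%N) : (i < n)%N ->
  (color_at g i + level g m i.+1 = color_at g i.+1 + level g m i %[mod r])%N.
Proof.
move=> lti; rewrite (level_step g m ltin lti) /step.
have := residue_subK (color_at g i) (color_at g i.+1).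
set x := residue _ _; set b := nat_of_bool _; set l := level _ _ _ => E.
rewrite -modnDml -E modnDml [RHS](_ : _ =
  ((b + m (Ordinal ltin)) * r + (x + color_at g i.+1 + l)) %% r)%N.
  by rewrite modnMDl.
by congr (_ %% _)%N; lia.
Qed.

Lemma backward_ind (P : nat -> Prop) :
  P n -> (forall i, (i < n)%N -> P i.+1 -> P i) -> forall i, (i <= n)%N -> P i.
Proof.
move=> Pn PS i; move Ej: (n - i)%N => j; elim: j i Ej => [|j IHj] i Ej lein.
  by have -> : i = n by lia.
by apply: PS; [|apply: IHj]; lia.
Qed.

Lemma level0E g i : level g (fun=> 0%N) i = lambda s g i.
Proof. by rewrite /level big1 ?addn0 // => j _; rewrite muln0. Qed.

(** The bound on the last color makes it equal to [lambda] there, and [color_level] with [m] zero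
    propagates the congruence downwards. *)
Lemma lambda_color g i : (color_at g n < e)%N -> (i <= n)%N ->
  (lambda s g i = color_at g i %[mod r])%N.
Proof.
move=> Ce; move: i; apply: backward_ind => [|i lti IHi]; first by rewrite lambda_last (modn_small Ce).
have := color_level g (fun=> 0%N) (leqW lti : (i < n.+1)%N) lti.
rewrite !level0E -modnDmr IHi modnDmr addnC => /eqP.
by rewrite eqn_modDl => /eqP ->.
Qed.

Lemma level_modn g m i : (level g m i = lambda s g i %[mod e])%N.
Proof.
rewrite /level (eq_bigr (fun j : 'I_n.+1 => e * (slack j * m j))%N) => [|j _].
  by rewrite -big_distrr /= addnC mulnC modnMDl.
by rewrite /wt /slack mulnA; case: ifP; rewrite ?muln1 // -rE.
Qed.

Let e_r : (e %| r)%N. Proof. by rewrite rE dvdn_mulr. Qed.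

(** Levels agree with [lambda] modulo [e], and [lambda] with the colors modulo [r], a multiple of
    [e]; so the exponent of [a] is read off the encoded function. *)
Lemma cp_col_level g m : (color_at g n < e)%N ->
  cp_col s g = (\sum_(i < n.+1) level g m i %% e)%N.
Proof.
move=> Ce; apply: eq_bigr => i _.
rewrite /residue modz_nat /= -/e level_modn -(modn_dvdm (lambda s g i) e_r).
by rewrite lambda_color ?modn_dvdm // -ltnS.
Qed.

(** Cancelling [s] shows that [p] divides [e * n.+1], hence every contribution of [m]; what remains,
    [cp_fmaj], is congruent to the sum of the colors modulo [p]. *)
Lemma dvdn_sum_level p g m : (p %| r)%N -> (p * s %| r * n.+1)%N ->
  (color_at g n < e)%N ->
  (p %| \sum_(i < n.+1) level g m i)%N = (g \in Grpn r n.+1 p).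
Proof.
move=> p_r ps_rn Ce.
have p_en : (p %| e * n.+1)%N.
  by rewrite -(dvdn_pmul2r s_gt0) mulnAC -rE.
rewrite sum_level inE dvdn_addl; last first.
  apply: dvdn_sum => j _; rewrite /wt dvdn_mulr //; case: eqP => [->|_] //.
  by rewrite dvdn_mulr.
rewrite /dvdn /cp_fmaj; congr (_ == _).
rewrite -[LHS]modn_summ -[RHS]modn_summ; congr (_ %% _)%N; apply: eq_bigr => i _.
rewrite -(modn_dvdm (lambda s g i) p_r) lambda_color ?modn_dvdm -1?ltnS //.
by rewrite (color_atE _ (ltn_ord i)); congr (color g _ %% _)%N; apply: val_inj.
Qed.

(** * Recovering a colored permutation from its levels *)

(** Consecutive levels coincide only if the colors agree and there is no descent; the permutation
    then increases, as the tie-break demands. *)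
Lemma level_sorted g m (f : 'I_n.+1 -> nat) :
  (forall i : 'I_n.+1, f (uperm g i) = level g m i) ->
  sorted (rank_lt f) [seq uperm g i | i <- enum 'I_n.+1].
Proof.
move=> fE; apply/(sortedP ord0) => i; rewrite size_map size_enum_ord => ltin.
have lti : (i < n.+1)%N := ltnW ltin.
have nthE k (ltk : (k < n.+1)%N) :
    nth ord0 [seq uperm g i | i <- enum 'I_n.+1] k = uperm g (Ordinal ltk).
  rewrite (nth_map (Ordinal ltk)) ?size_enum_ord //; congr (uperm g _).
  exact: (nth_ord_enum _ (Ordinal ltk)).
rewrite (nthE _ ltin) (nthE _ lti).
rewrite /rank_lt !fE /= (level_step g m lti) // /step.
rewrite (perm_atE g lti) (perm_atE g ltin).
have := residue_subK (color_at g i) (color_at g i.+1).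
set x := residue _ _ => Ex; set l := level _ _ _.
case: (posnP x) => [x0|]; last by lia.
move: Ex; rewrite x0 add0n !modn_small ?color_at_lt // => ->; rewrite eqxx /=.
have : uperm g (Ordinal lti) != uperm g (Ordinal ltin).
  by rewrite (inj_eq perm_inj) -val_eqE /= neq_ltn ltnSn.
rewrite -val_eqE /=; move: (nat_of_ord _) (nat_of_ord _) => a b.
by case: (ltngtP a b) => //= _ _; rewrite ?muln1 ?muln0; lia.
Qed.

Lemma color_at_inj g g' : uperm g = uperm g' ->
  (forall i, (i <= n)%N -> color_at g i = color_at g' i) -> g = g'.
Proof.
move=> Eu Ec; apply: colored_permP => // i; apply: val_inj.
have := Ec i; rewrite -ltnS ltn_ord => /(_ isT).
by rewrite !(color_atE _ (ltn_ord i)) (_ : Ordinal _ = i) //; apply: val_inj.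
Qed.

(** The data are recovered in order: the permutation by uniqueness of sorting, the levels, the last
    color as the last level modulo [e], the other colors by [color_level], and [m] by cancelling
    [step]. *)
Lemma level_inj g g' m m' : (color_at g n < e)%N -> (color_at g' n < e)%N ->
  (forall x : 'I_n.+1,
     level g m (uperm g^-1%g x) = level g' m' (uperm g'^-1%g x)) ->
  g = g' /\ m =1 m'.
Proof.
move=> Ce Ce' Ef; pose f x := level g m (uperm g^-1%g x).
have fg i : f (uperm g i) = level g m i by rewrite /f /= permK.
have fg' i : f (uperm g' i) = level g' m' i by rewrite /f Ef /= permK.
have Eu : uperm g = uperm g'.
  by apply: (rank_lt_perm_inj (f := f)); [apply: level_sorted fg|apply: level_sorted fg'].
have El i : (i <= n)%N -> level g m i = level g' m' i.
  by move=> lein; rewrite -(fg (Ordinal (lein : i < n.+1)%N)) Eu fg'.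
have Ec i : (i <= n)%N -> color_at g i = color_at g' i.
  move: i; apply: backward_ind => [|i lti IHi].
    have := El n (leqnn n); rewrite !level_last !modn_small // => /(congr1 (modn^~ e)).
    by rewrite ![(_ + e * _)%N]addnC ![(e * _)%N]mulnC !modnMDl !modn_small.
  have := color_level g m (leqW lti : (i < n.+1)%N) lti.
  rewrite IHi El // El 1?ltnW // -(color_level g' m' (leqW lti : (i < n.+1)%N) lti).
  by move/eqP; rewrite eqn_modDr !modn_small ?color_at_lt // => /eqP.
split; first exact: color_at_inj.
move=> i; have [lti|] := ltnP i n.
  have := El i (ltnW lti).
  rewrite (level_step _ _ (ltn_ord i) lti) (level_step _ _ (ltn_ord i) lti).
  have <- : step g i = step g' i by rewrite /step /perm_at Eu !Ec // ltnW.
  rewrite El // (_ : Ordinal _ = i); last exact: val_inj.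
  by move/eqP; rewrite eqn_add2l eqn_pmul2l // => /eqP.
move=> leni; have -> : i = ord_max by apply/val_inj/anti_leq; rewrite leni -ltnS ltn_ord.
have := El n (leqnn n); rewrite !level_last Ec // => /eqP.
by rewrite eqn_add2l eqn_pmul2l // => /eqP.
Qed.

Lemma level_surj (f : 'I_n.+1 -> nat) : exists g m,
  (color_at g n < e)%N /\ forall i : 'I_n.+1, level g m i = f (uperm g i).
Proof.
have [sigma sorted_sigma] := rank_lt_perm_exists f.
pose l (i : nat) := f (sigma (inord i)).
have l_step i : (i < n)%N -> rank_lt f (sigma (inord i)) (sigma (inord i.+1)).
  move=> lti; have /(sortedP ord0)/(_ i) := sorted_sigma.
  rewrite size_map size_enum_ord ltnS => /(_ lti).
  have nthE k : (k < n.+1)%N ->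
      nth ord0 [seq sigma i | i <- enum 'I_n.+1] k = sigma (inord k).
    move=> ltk; rewrite (nth_map ord0) ?size_enum_ord //; congr (sigma _).
    by apply: val_inj; rewrite /= nth_enum_ord // inordK.
  by rewrite !nthE // ltnW.
have l_ge i : (i <= n)%N -> (l n <= l i)%N.
  move: i; apply: backward_ind => // i lti IHi; apply: leq_trans IHi _.
  by move: (l_step i lti); rewrite /rank_lt -/(l i) -/(l i.+1); lia.
(* The shift makes the last color [l n %% e]; by [l_ge] the subtraction is never truncated. *)
pose c i := ((l i - e * (l n %/ e)) %% r)%N.
pose g : colored_perm r n.+1 := ColoredPerm [ffun i : 'I_n.+1 => inord (c i)] sigma.
have gc i : (i <= n)%N -> color_at g i = c i.
  move=> lein; rewrite (color_atE g (lein : i < n.+1)%N) ffunE inordK //.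
  by rewrite prednK // ltn_pmod.
(* Away from the last position this counts the multiples of [r] in the drop of [l], less the one
   that [step] already includes at a descent. *)
pose m (i : 'I_n.+1) := if (i : nat) == n then (l n %/ e)%N else
  ((l i - l i.+1) %/ r
    - ((color_at g i == color_at g i.+1) && (perm_at g i.+1 < perm_at g i)))%N.
have cn : c n = (l n %% e)%N.
  rewrite /c mulnC [X in (X - _)%N](divn_eq _ e) addKn modn_small //.
  by apply: leq_trans (ltn_pmod _ e_gt0) (dvdn_leq r_gt0 e_r).
exists g, m; split; first by rewrite gc // cn ltn_pmod.
suff El i : (i <= n)%N -> level g m i = l i.
  by move=> i; rewrite El -1?ltnS // /l inord_val.
move: i; apply: backward_ind => [|i lti IHi].
  by rewrite level_last gc // cn /m eqxx modn_mod addnC mulnC -divn_eq.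
have lt' : (i < n.+1)%N := leqW lti.
rewrite (level_step g m lt' lti) IHi /step /m /= (ltn_eqF lti).
have := residue_subK (color_at g i) (color_at g i.+1).
have := residue_lt ((color_at g i)%:Z - (color_at g i.+1)%:Z).
have := l_step i lti; rewrite /rank_lt -/(l i) -/(l i.+1) => l_lt.
have Ec : (color_at g i = (l i - l i.+1) + color_at g i.+1 %[mod r])%N.
  rewrite (gc i (ltnW lti)) (gc i.+1 lti) /c modnDmr modn_mod; congr (_ %% _)%N.
  have := l_ge i.+1 lti; have := leq_divM (l n) e; lia.
set x := residue _ _ => ltxr Ex.
have {Ex} Ex : x = ((l i - l i.+1) %% r)%N.
  move: Ex; rewrite Ec => /eqP; rewrite eqn_modDr => /eqP <-.
  by rewrite modn_small.
have := divn_eq (l i - l i.+1) r; rewrite -Ex; set d := (_ %/ r)%N => Ed.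
set b := _ && _.
have le_l : (l i.+1 <= l i)%N by move: l_lt; clear; lia.
(* The subtraction in [m] is exact once a descent forces a drop of at least [r]: equal colors make
   the drop a multiple of [r], and a zero drop would contradict the tie-break. *)
suff led : (b <= d)%N.
  have : (r * b + r * (d - b) = d * r)%N by rewrite -mulnDr subnKC // mulnC.
  move: Ed le_l; clear; move: (r * b)%N (r * (d - b))%N (d * r)%N => u v w.
  by lia.
case Eb: b => //; rewrite lt0n; apply/eqP => d0.
move: Eb; rewrite /b => /andP[/eqP Ec' ltP].
have x0 : x = 0%N.
  move/esym/eqP: Ec; rewrite Ec' -[X in _ == X %[mod r]]add0n eqn_modDr.
  by rewrite -Ex mod0n => /eqP.
have inordE k (ltk : (k < n.+1)%N) : Ordinal ltk = inord k.
  by apply: val_inj; rewrite /= inordK.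
move: ltP l_lt; rewrite (perm_atE g lt') (perm_atE g (lti : (i.+1 < n.+1)%N)).
rewrite !inordE /=; move: Ed le_l; rewrite x0 d0; clear; lia.
Qed.

(** * The bijection between functions and encodable pairs *)

Section Sum.
Variables (p K : nat).
Hypotheses (p_r : (p %| r)%N) (ps_rn : (p * s %| r * n.+1)%N).

(* The exponents m_j are bounded by K only to make the index type finite: the
   last condition already forces it. *)
Definition encodable (x : colored_perm r n.+1 * {ffun 'I_n.+1 -> 'I_K.+1}) :=
  [&& x.1 \in Grpn r n.+1 p, (color_at x.1 n < e)%N
    & (cp_des s x.1 + \sum_(j < n.+1) slack j * x.2 j <= K)%N].

(** The default value of [inord] is never taken on encodable pairs, whose levels are at most
    [e * K]. *)
Definition encode (x : colored_perm r n.+1 * {ffun 'I_n.+1 -> 'I_K.+1}) :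
    {ffun 'I_n.+1 -> 'I_(e * K).+1} :=
  [ffun y => inord (level x.1 (fun j => x.2 j) ((uperm x.1)^-1%g y))].

Lemma level_le0 g m i : (i <= n)%N -> (level g m i <= level g m 0)%N.
Proof.
elim: i => // i IHi lti; apply: leq_trans (IHi (ltnW lti)).
by rewrite (level_step g m (leqW lti : (i < n.+1)%N) lti) -addnA leq_addr.
Qed.

Lemma encodeE x y : encodable x ->
  encode x y = level x.1 (fun j => x.2 j) ((uperm x.1)^-1%g y) :> nat.
Proof.
case/and3P => _ _; rewrite -level0_le => le_eK.
by rewrite ffunE inordK // ltnS (leq_trans (level_le0 _ _ _)) // -ltnS.
Qed.

Lemma encode_inj : {in encodable &, injective encode}.
Proof.
move=> [g m] [g' m'] Eg Eg' E.
have /and3P[_ /= Ce _] := Eg; have /and3P[_ /= Ce' _] := Eg'.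
have [|-> Em] := level_inj (m := fun j => m j) (m' := fun j => m' j) Ce Ce'.
  by move=> x; rewrite -(encodeE x Eg) -(encodeE x Eg') E.
by congr (_, _); apply/ffunP => j; apply: val_inj; apply: Em.
Qed.

Lemma encode_sum (G : nat -> nat) x : encodable x ->
  (\sum_i G (encode x i) = \sum_(i < n.+1) G (level x.1 (fun j => x.2 j) i))%N.
Proof.
move=> Ex; rewrite [LHS](reindex_perm (uperm x.1)).
by apply: eq_bigr => i _; rewrite encodeE // permK.
Qed.

Lemma slack_gt0 j : (0 < slack j)%N.
Proof. by rewrite /slack; case: ifP. Qed.

Lemma encode_surj (f : {ffun 'I_n.+1 -> 'I_(e * K).+1}) :
  (p %| \sum_i f i)%N -> exists2 x, encodable x & encode x = f.
Proof.
move=> pf; have [g [m [Ce Ef]]] := level_surj (fun i => f i).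
have le_K : (cp_des s g + \sum_(j < n.+1) slack j * m j <= K)%N.
  by rewrite -level0_le (Ef ord0) -ltnS.
have le_mK j : (m j <= K)%N.
  apply: leq_trans (leq_pmull _ (slack_gt0 j)) _; apply: leq_trans le_K.
  by rewrite (bigD1 j) //= addnCA leq_addr.
pose m' : {ffun 'I_n.+1 -> 'I_K.+1} := [ffun j => inord (m j)].
have m'E j : m' j = m j :> nat by rewrite ffunE inordK // ltnS.
have level_m' i : level g (fun j => m' j) i = level g m i.
  by congr (_ + _)%N; apply: eq_bigr => j _; rewrite m'E.
have Egm : encodable (g, m').
  apply/and3P; split=> //=; last by rewrite -level0_le level_m' level0_le.
  rewrite -(dvdn_sum_level m p_r ps_rn Ce) (eq_bigr _ (fun i _ => Ef i)).
  by move: pf; rewrite (reindex_perm (uperm g)).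
exists (g, m') => //; apply/ffunP => y; apply: val_inj.
by rewrite /= encodeE //= level_m' Ef permKV.
Qed.

Lemma sum_encode (V : nmodType) (G : nat -> nat -> V) :
  \sum_(f : {ffun 'I_n.+1 -> 'I_(e * K).+1} | (p %| \sum_i f i)%N)
     G (\sum_i f i)%N (\sum_i f i %% e)%N =
  \sum_(x | encodable x)
     G (cp_fmaj s x.1 + \sum_(j < n.+1) wt j * j.+1 * x.2 j)%N (cp_col s x.1).
Proof.
transitivity (\sum_(f in encode @: [set x | encodable x])
     G (\sum_i f i)%N (\sum_i f i %% e)%N).
  apply: eq_bigl => f; apply/idP/imsetP => [/encode_surj[x Ex <-]|[x]].
    by exists x; rewrite ?inE.
  rewrite inE => Ex ->; rewrite (encode_sum id Ex).
  by have /and3P[xG Ce _] := Ex; rewrite dvdn_sum_level.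
rewrite big_imset /=; last by move=> x y; rewrite !inE; apply: encode_inj.
apply: eq_big => x; first by rewrite inE.
rewrite inE => Ex; have /and3P[_ Ce _] := Ex.
by rewrite (encode_sum id Ex) (encode_sum (modn^~ e) Ex) sum_level -cp_col_level.
Qed.

End Sum.

End Encoding.

(** * Canonical representatives of the cosets of C_s *)

Section CosetRepresentatives.
Variables r p s n : nat.
Hypotheses (r_gt0 : (0 < r)%N) (p_r : (p %| r)%N) (s_r : (s %| r)%N).
Hypothesis ps_rn : (p * s %| r * n.+1)%N.
Implicit Types g h : colored_perm r n.+1.

Let e := (r %/ s)%N.

Lemma coset_Cs_eqP g h :
  reflect (exists2 z, z \in Cs r n.+1 s & g = (z * h)%g)
          (coset (Cs r n.+1 s) g == coset (Cs r n.+1 s) h).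
Proof.
have N x : x \in 'N(Cs r n.+1 s)%g by apply: subsetP (cent_sub _) _ (Cs_cent s x).
apply: (iffP eqP) => [/(rcoset_kercosetP (N g) (N h))/rcosetP //|[z zC ->]].
by apply/(rcoset_kercosetP (N _) (N h))/rcosetP; exists z.
Qed.

Definition canonical g := (g \in Grpn r n.+1 p) && (color_at g n < e)%N.

(** An element of C_s shifts all colors by a common multiple of [e]; if both last colors are below
    [e] they agree, so the shift vanishes modulo [r]. *)
Lemma coset_canonical_inj :
  {in canonical &, injective (coset (Cs r n.+1 s))}.
Proof.
move=> g h /andP[_ Cg] /andP[_ Ch] /eqP/coset_Cs_eqP[z zC gE].
have [_ [m e_m Cz]] := color_at_Cs r_gt0 h zC; rewrite -gE in Cz.
have e_r : (e %| r)%N by rewrite -[X in (_ %| X)%N](divnK s_r) dvdn_mulr.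
have Cn : color_at g n = color_at h n.
  have := Cz n (ltnSn n) => /(congr1 (modn^~ e)).
  by rewrite modn_dvdm // -modnDmr (eqP e_m) addn0 !modn_small.
have r_m : (m %% r = 0)%N.
  have := Cz n (ltnSn n); rewrite Cn -[LHS](modn_small (color_at_lt r_gt0 h n)).
  by rewrite -{1}[color_at h n]addn0 => /eqP; rewrite eqn_modDl mod0n => /eqP.
apply: color_at_inj => [|i lein]; first by have [uE _] := color_Cs r_gt0 h zC; rewrite gE.
by rewrite Cz // -modnDmr r_m addn0 modn_small // color_at_lt.
Qed.

Lemma coset_canonical_surj g : g \in Grpn r n.+1 p ->
  exists2 h, canonical h & coset (Cs r n.+1 s) h = coset (Cs r n.+1 s) g.
Proof.
move=> gG; pose z : colored_perm r n.+1 := ColoredPerm [ffun=> inZp e] 1%g.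
have color_zM g' i : color (z * g')%g i = ((color g' i + e) %% r)%N :> nat.
  have modE (x y : nat) : ((x + y %% r.-1.+1) %% r.-1.+1 = (x + y) %% r)%N.
    by rewrite prednK // modnDmr.
  by rewrite ffunE /= ffunE /= modE.
have color_z k g' i : color (z ^+ k * g')%g i = ((color g' i + k * e) %% r)%N :> nat.
  elim: k => [|k IHk].
    rewrite expg0 mul1g addn0 modn_small // -[X in (_ < X)%N](prednK r_gt0).
    exact: ltn_ord.
  by rewrite expgS -mulgA color_zM IHk modnDml mulSn addnAC addnA.
(* This power adds [(s - 1) q e = q r - q e] to every color, that is, subtracts [q e] modulo [r],
   leaving the last color reduced modulo [e]. *)
pose q := (color_at g n %/ e)%N; pose h := (z ^+ (s.-1 * q) * g)%g.
have zC : (z ^+ (s.-1 * q))%g \in Cs r n.+1 s by apply: mem_cycle.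
have s_gt0 : (0 < s)%N := dvdn_gt0 r_gt0 s_r.
have rE : r = (e * s)%N by rewrite /e divnK.
have e_gt0 : (0 < e)%N by move: r_gt0; rewrite {1}rE muln_gt0 => /andP[].
exists h; last by apply/eqP/coset_Cs_eqP; exists (z ^+ (s.-1 * q))%g.
apply/andP; split.
  have /andP[/subsetP CG _] := Cs_normal r_gt0 p_r s_r ps_rn.
  have /group_setP[_ GM] := group_set_Grpn n.+1 r_gt0 p_r.
  by apply: GM => //; apply: CG.
rewrite (color_atE h (ltnSn n)) color_z -color_atE (divn_eq (color_at g n) e) -/q.
have -> : (q * e + color_at g n %% e + s.-1 * q * e = q * r + color_at g n %% e)%N.
  by rewrite {2}rE; case: (s) s_gt0 => // s' _ /=; rewrite !mulnS; lia.
rewrite modnMDl modn_small ?ltn_pmod // (leq_trans (ltn_pmod _ e_gt0)) //.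
by rewrite {1}rE leq_pmulr.
Qed.

Lemma sum_Grpsn (V : nmodType) (F : coset_of (Cs r n.+1 s) -> V) :
  \sum_(x in Grpsn r p s n.+1) F x =
  \sum_(g | canonical g) F (coset (Cs r n.+1 s) g).
Proof.
transitivity (\sum_(x in coset (Cs r n.+1 s) @: [set g | canonical g]) F x).
  apply: eq_bigl => x; apply/morphimP/imsetP => [[g _ gG ->]|[g]].
    by have [h hc E] := coset_canonical_surj gG; exists h; rewrite ?inE // -E.
  rewrite inE => /andP[gG _] ->; exists g => //.
  exact: subsetP (cent_sub _) _ (Cs_cent s g).
rewrite big_imset /=; last by move=> x y; rewrite !inE; apply: coset_canonical_inj.
by apply: eq_bigl => g; rewrite inE.
Qed.

End CosetRepresentatives.

(** * Expansion of the right-hand side and comparison *)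

(** The last factor becomes the case [j = n] of a uniform product; [1 - t] stays apart because it
    will produce partial sums. *)
Lemma denominatorE (S : comPzRingType) (t q : S) (r s n : nat) : (s %| r)%N ->
  (1 - t) * (\prod_(1 <= i < n.+1) (1 - t ^+ s * q ^+ (i * r)))
    * (1 - t * q ^+ (n.+1 * r %/ s)) =
  (1 - t) * \prod_(j < n.+1) (1 - t ^+ slack s n j * q ^+ (wt r s n j * j.+1)).
Proof.
move=> s_r; rewrite -mulrA big_ord_recr /= big_add1 big_mkord.
congr (_ * (_ * (1 - _))).
  by apply: eq_bigr => j _; rewrite /slack /wt /= ltn_eqF // mulnC.
by rewrite /slack /wt /= eqxx expr1 -muln_divA // mulnC.
Qed.

Lemma mul_prod_monom (S : comPzRingType) (I : finType) (t q a : S)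
    (d w c : nat) (b v m : I -> nat) :
  t ^+ d * q ^+ w * a ^+ c * \prod_j (t ^+ b j * q ^+ v j) ^+ m j =
  t ^+ (d + \sum_j b j * m j)%N * (q ^+ (w + \sum_j v j * m j)%N * a ^+ c).
Proof.
under eq_bigr => j _ do rewrite exprMn -!exprM.
by rewrite big_split /= -!expr_sum !exprD; ring.
Qed.

(** Gathering [q] and [a] under [fpsC] exhibits a monomial in [t], ready for [coefs_monom]. *)
Lemma mul_prod_fps_monom (R : comUnitRingType) (I : finType)
    (d w c : nat) (b v m : I -> nat) :
  let t : {fps {fps {fps R}}} := fpsX in
  let q : {fps {fps {fps R}}} := fpsC fpsX in
  let a : {fps {fps {fps R}}} := fpsC (fpsC fpsX) in
  t ^+ d * q ^+ w * a ^+ c * \prod_j (t ^+ b j * q ^+ v j) ^+ m j =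
  t ^+ (d + \sum_j b j * m j)%N
    * fpsC (fpsX ^+ (w + \sum_j v j * m j)%N * fpsC fpsX ^+ c).
Proof. by move=> t q a; rewrite mul_prod_monom rmorphM !rmorphXn. Qed.

Lemma exprS_mull (S : pzRingType) (x y : S) b :
  (0 < b)%N -> x ^+ b * y = x * (x ^+ b.-1 * y).
Proof. by case: b => // b _; rewrite exprS mulrA. Qed.

Theorem theorem5p2 (r p s n : nat) :
  (0 < r)%N -> (0 < p)%N -> (0 < s)%N -> (0 < n)%N ->
  (p %| r)%N -> (s %| r)%N -> (p * s %| r * n)%N ->
  let lhs : fps_tqa :=
    let q : fps_qa := fpsX in
    let a : fps_qa := fpsC fpsX in
    Fps (fun k : nat =>
      (qint k.+1 (q ^+ (r %/ s))
       + a * q * qint k (q ^+ (r %/ s)) * qint (r %/ s).-1 (a * q)) ^+ n) in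
  let t : fps_tqa := fpsX in
  let q : fps_tqa := fpsC fpsX in
  let a : fps_tqa := fpsC (fpsC fpsX) in
  qfilter p lhs =
  (\sum_(g in Grpsn r p s n) t ^+ des g * q ^+ fmaj g * a ^+ col_stat g)
  / ((1 - t) * (\prod_(1 <= i < n) (1 - t ^+ s * q ^+ (i * r)))
     * (1 - t * q ^+ (n * r %/ s))).
Proof.
move=> r_gt0 p_gt0 s_gt0; case: n => // n _ p_r s_r ps_rn lhs t q a.
have e_gt0 : (0 < r %/ s)%N by rewrite divn_gt0 // dvdn_leq.
pose M (j : 'I_n.+1) : fps_tqa := t ^+ slack s n j * q ^+ (wt r s n j * j.+1).
rewrite denominatorE // (_ : \prod_j (1 - _) = \prod_j (1 - M j)) //.
have XM j : exists H, M j = fpsX * H.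
  exists (t ^+ (slack s n j).-1 * q ^+ (wt r s n j * j.+1)).
  by apply: exprS_mull; apply: slack_gt0 s_r _.
rewrite (sum_Grpsn r_gt0 p_r s_r ps_rn); set N := \sum_(g | _) _.
apply/fpsP => K; rewrite (coef_qfilter_power p e_gt0 (K := K) (n := n.+1) (F := lhs)) //.
rewrite (sum_encode r_gt0 s_r K p_r ps_rn
  (fun w c => (fpsX : fps_qa) ^+ w * (fpsC fpsX : fps_qa) ^+ c)).
have U1 : 1 - t \is a GRing.unit by rewrite -[t]mulr1 unit_sub1X.
have UM : \prod_j (1 - M j) \is a GRing.unit.
  by apply: rpred_prod => j _; have [H ->] := XM j; apply: unit_sub1X.
(* The uniform product is expanded with exponents [m]; the remaining division by [1 - t] sums the
   coefficients up to [K], turning an equality of [t]-degrees into the inequality of [encodable]. *)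
rewrite invrM // [_^-1 * _^-1]mulrC mulrA (coefs_div_prod_geom _ _ XM) coefs_sum.
pose G w c : fps_qa := fpsX ^+ w * (fpsC fpsX) ^+ c.
rewrite [RHS](_ : _ = \sum_(m : {ffun 'I_n.+1 -> 'I_K.+1})
  \sum_(g : colored_perm r n.+1 | canonical p s g)
    if (cp_des s g + \sum_(j < n.+1) slack s n j * m j <= K)%N then
      G (cp_fmaj s g + \sum_(j < n.+1) wt r s n j * j.+1 * m j)%N (cp_col s g)
    else 0); last first.

  apply: eq_bigr => m _; rewrite mulrAC coefs_div_sub1X.
  have -> : N * \prod_j M j ^+ m j = \sum_(g : colored_perm r n.+1 | canonical p s g)
     t ^+ (cp_des s g + \sum_(j < n.+1) slack s n j * m j)%N *
     fpsC (G (cp_fmaj s g + \sum_(j < n.+1) wt r s n j * j.+1 * m j)%N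
       (cp_col s g)).
    rewrite mulr_suml; apply: eq_bigr => g _.
    rewrite (des_coset r_gt0 s_r g (ltn0Sn n)) (fmaj_coset r_gt0 s_r g (ltn0Sn n)).
    rewrite (col_coset r_gt0 s_r g (ltn0Sn n)).
    exact: (@mul_prod_fps_monom int 'I_n.+1 _ _ _
      (slack s n) (fun j => wt r s n j * j.+1)%N (fun j => m j)).
  under eq_bigr => k _ do rewrite coefs_sum.
  rewrite exchange_big; apply: eq_bigr => g _.
  under eq_bigr => k _ do rewrite coefs_monom.
  rewrite -big_mkcond /=; set b := (_ + _)%N.
  case: ifP => [lebK|/negbT gtbK].
    by rewrite (big_pred1 (Ordinal (lebK : (b < K.+1)%N))) // => k; rewrite -val_eqE eq_sym.
  rewrite big_pred0 // => k; apply: contraNF gtbK => /eqP ->.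
  by rewrite -ltnS.
(* [encodable] is [canonical] together with the degree bound, so both sides now agree pair by
   pair. *)
rewrite exchange_big pair_big_dep /= [RHS]big_mkcond [LHS]big_mkcond.
apply: eq_bigr => -[g m] _ /=.
by rewrite /encodable /canonical /= andbA andbT if_and.
Qed.
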